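(* Let $(\mathfrak{g},\pi,T)$ be an extended Rota-Baxter Lie algebra of weight $(\mu,\lambda)$ and let $(M,T_M)$ be an extended Rota-Baxter representation over it. For $a\in\mathfrak{g}$, $m\in M$ define $$[a,m]_t:=[T(a),m]-T_M([a,m]).$$ Then this action, together with $T_M$, makes $M$ into an extended Rota-Baxter representation over the extended Rota-Baxter Lie algebra $\mathfrak{g}_\star=(\mathfrak{g},[-,-]_\star,T)$ of weight $(\mu,\lambda)$.
   Context: $\mathbf{k}$ is a field of characteristic $0$ and $\mu,\lambda\in\mathbf{k}$. An extended Rota-Baxter Lie algebra of weight $(\mu,\lambda)$ is a Lie algebra $(\mathfrak{g},\pi=[-,-])$ over $\mathbf{k}$ with a linear map $T:\mathfrak{g}\to\mathfrak{g}$ such that $[T(a),T(b)]=T([T(a),b]+[a,T(b)]+\mu[a,b])+\lambda[a,b]$ for all $a,b$. An extended Rota-Baxter representation of $(\mathfrak{g},\pi,T)$ is a representation $(M,\rho)$ of the Lie algebra $\mathfrak{g}$, written $[a,m]:=\rho(a)m$, with a linear map $T_M:M\to M$ such that $[T(a),T_M(m)]=T_M([a,T_M(m)]+[T(a),m]+\mu[a,m])+\lambda[a,m]$ for all $a\in\mathfrak{g},m\in M$. The bracket $[-,-]_\star$ is $[a,b]_\star:=[a,T(b)]+[T(a),b]+\mu[a,b]$; $(\mathfrak{g},[-,-]_\star,T)$ is an extended Rota-Baxter Lie algebra of weight $(\mu,\lambda)$, denoted $\mathfrak{g}_\star$. *)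

(* Defs.v *)
From mathcomp Require Import all_boot all_order all_algebra.

Set Implicit Arguments.
Unset Strict Implicit.
Unset Printing Implicit Defensive.

Import GRing.Theory.
Local Open Scope ring_scope.

Record lieAlgebra (k : fieldType) := LieAlgebra {
  lie_sort :> lmodType k;
  lie_br : lie_sort -> lie_sort -> lie_sort;
  lie_brPl : forall b, linear (lie_br^~ b);
  lie_brPr : forall a, linear (lie_br a);
  lie_brxx : forall a, lie_br a a = 0;
  lie_jacobi : forall a b c,
    lie_br a (lie_br b c) + lie_br b (lie_br c a) + lie_br c (lie_br a b) = 0
}.

Arguments lie_br {k g} : rename.

Record extRBLieAlgebra (k : fieldType) (mu lam : k) := ExtRBLieAlgebra {
  erb_lie :> lieAlgebra k;
  erb_op : {linear erb_lie -> erb_lie};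
  erb_opP : forall a b : erb_lie,
    lie_br (erb_op a) (erb_op b) =
      erb_op (lie_br (erb_op a) b + lie_br a (erb_op b) + mu *: lie_br a b)
      + lam *: lie_br a b
}.

(* The linear map g -> gl(M) is given in uncurried form, as a bilinear action
   [rho a m]; M need not be finite-dimensional. *)
Record is_lie_rep (k : fieldType) (g : lieAlgebra k) (M : lmodType k)
    (rho : g -> M -> M) : Prop := IsLieRep {
  lie_repPl : forall m, linear (rho^~ m);
  lie_repPr : forall a, linear (rho a);
  lie_rep_br : forall a b m,
    rho (lie_br a b) m = rho a (rho b m) - rho b (rho a m)
}.

Record is_extRB_rep (k : fieldType) (mu lam : k) (g : extRBLieAlgebra mu lam)
    (M : lmodType k) (rho : g -> M -> M) (TM : {linear M -> M}) : Prop :=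
    IsExtRBRep {
  extRB_rep_lie : is_lie_rep rho;
  extRB_repP : forall (a : g) m,
    rho (erb_op g a) (TM m) =
      TM (rho a (TM m) + rho (erb_op g a) m + mu *: rho a m) + lam *: rho a m
}.

Section Star.

Variables (k : fieldType) (mu lam : k) (g : extRBLieAlgebra mu lam).

Local Notation T := (erb_op g).

Definition star_br (a b : g) : g :=
  lie_br a (T b) + lie_br (T a) b + mu *: lie_br a b.

Local Lemma brDl (a b c : g) : lie_br (a + b) c = lie_br a c + lie_br b c.
Proof. by have := lie_brPl c 1 a b; rewrite !scale1r. Qed.

Local Lemma brDr (a b c : g) : lie_br a (b + c) = lie_br a b + lie_br a c.
Proof. by have := lie_brPr a 1 b c; rewrite !scale1r. Qed.

Local Lemma brx0 (a : g) : lie_br a 0 = 0.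
Proof. by apply: (@addrI _ (lie_br a 0)); rewrite -brDr !addr0. Qed.

Local Lemma br0x (a : g) : lie_br 0 a = 0.
Proof. by apply: (@addrI _ (lie_br 0 a)); rewrite -brDl !addr0. Qed.

Local Lemma brZl x (a b : g) : lie_br (x *: a) b = x *: lie_br a b.
Proof. by have := lie_brPl b x a 0; rewrite /= !addr0 br0x addr0. Qed.

Local Lemma brZr x (a b : g) : lie_br a (x *: b) = x *: lie_br a b.
Proof. by have := lie_brPr a x b 0; rewrite !addr0 brx0 addr0. Qed.

Local Lemma br_anti (a b : g) : lie_br a b + lie_br b a = 0.
Proof.
by have := lie_brxx (a + b); rewrite brDl !brDr !lie_brxx add0r addr0.
Qed.

Local Lemma erb_op_star (a b : g) :
  T (star_br a b) = lie_br (T a) (T b) - lam *: lie_br a b.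
Proof. by rewrite erb_opP addrK /star_br [X in T (X + _)]addrC. Qed.

Local Lemma star_brPl b : linear (star_br^~ b).
Proof.
move=> x a c; rewrite /star_br linearP !brDl !brZl !scalerDr.
rewrite !scalerA [mu * x]mulrC !addrA.
by rewrite (ACl (1*3*5*2*4*6)).
Qed.

Local Lemma star_brPr a : linear (star_br a).
Proof.
move=> x b c; rewrite /star_br linearP !brDr !brZr !scalerDr.
rewrite !scalerA [mu * x]mulrC !addrA.
by rewrite (ACl (1*3*5*2*4*6)).
Qed.

Local Lemma star_brxx a : star_br a a = 0.
Proof. by rewrite /star_br br_anti lie_brxx scaler0 addr0. Qed.

Local Lemma star_jacobi a b c :
  star_br a (star_br b c) + star_br b (star_br c a) + star_br c (star_br a b)
  = 0.
Proof.
have E x y z : star_br x (star_br y z) =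
    lie_br x (lie_br (T y) (T z)) + lie_br (T x) (lie_br y (T z))
    + lie_br (T x) (lie_br (T y) z)
    + mu *: (lie_br (T x) (lie_br y z) + lie_br x (lie_br y (T z))
             + lie_br x (lie_br (T y) z))
    + (mu * mu - lam) *: lie_br x (lie_br y z).
  rewrite {1}/star_br erb_op_star /star_br -scaleNr !brDr !brZr !scalerDr.
  rewrite scalerDl scalerA !addrA.
  by rewrite (ACl (1*3*4*5*6*7*8*2)).
rewrite !E !scalerDr !addrA.
rewrite (ACl ((1*10*16)*(2*8*17)*(3*9*15)*(4*12*20)*(6*11*19)*(5*13*18)
              *(7*14*21))) /=.
by rewrite -!scalerDr !lie_jacobi !scaler0 !addr0.
Qed.

Definition star_lie : lieAlgebra k :=
  LieAlgebra star_brPl star_brPr star_brxx star_jacobi.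

Local Lemma star_opP (a b : g) :
  star_br (T a) (T b) =
    T (star_br (T a) b + star_br a (T b) + mu *: star_br a b)
    + lam *: star_br a b.
Proof.
have E (x y : g) : lie_br (T x) (T y) = T (star_br x y) + lam *: lie_br x y.
  by rewrite erb_op_star subrK.
have S x y : star_br x y =
    lie_br x (T y) + lie_br (T x) y + mu *: lie_br x y by [].
rewrite [LHS]S !E [X in _ = _ + lam *: X]S.
move: (star_br (T a) b) (star_br a (T b)) (star_br a b) => u v w.
rewrite !linearD [T (_ *: _)]linearZ /= !scalerA [mu * lam]mulrC !addrA.
by rewrite (ACl (3*1*5*2*4*6)).
Qed.

Definition star_extRBLie : extRBLieAlgebra mu lam :=
  @ExtRBLieAlgebra k mu lam star_lie T star_opP.

End Star.

Definition act_t (k : fieldType) (mu lam : k) (g : extRBLieAlgebra mu lam)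
    (M : lmodType k) (rho : g -> M -> M) (TM : {linear M -> M})
    (a : g) (m : M) : M :=
  rho (erb_op g a) m - TM (rho a m).

(* Main.v *)
Require Import Defs.
From mathcomp Require Import all_boot all_order all_algebra.

Set Implicit Arguments.
Unset Strict Implicit.
Unset Printing Implicit Defensive.

Import GRing.Theory.
Local Open Scope ring_scope.

(** The Rota-Baxter identity of [T], solved for the image of the star bracket, reads [T (star_br a
    b) = [T a, T b] - lam [a, b]]. The one on [M] has an expansion of [act_t] free of nested [TM],
    both for [act_t a (act_t b m)] ([act_t_act_t]) and for [act_t a (TM m)]. The first reduces
    compatibility with the star bracket to commutators of [rho] ([act_t_star_br]); the second makes
    the Rota-Baxter identity of [act_t] a cancellation ([act_t_extRB]). *)

Section DerivedAction.

Variables (k : fieldType) (mu lam : k) (g : extRBLieAlgebra mu lam).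
Variables (M : lmodType k) (rho : g -> M -> M) (TM : {linear M -> M}).
Hypothesis M_rep : is_extRB_rep rho TM.

Local Notation T := (erb_op g).
Local Notation rho_lie := (extRB_rep_lie M_rep).

Lemma act_tPl m : linear ((act_t rho TM)^~ m).
Proof.
move=> x a b; rewrite /act_t linearP !(lie_repPl rho_lie) linearP.
by rewrite scalerBr opprD !addrA (ACl (1*3*2*4)).
Qed.

Lemma act_tPr a : linear (act_t rho TM a).
Proof.
move=> x m n; rewrite /act_t !(lie_repPr rho_lie) linearP.
by rewrite scalerBr opprD !addrA (ACl (1*3*2*4)).
Qed.

(* The extended Rota-Baxter identity at [rho b m] cancels the terms in which
   [TM] occurs twice. *)
Lemma act_t_act_t a b m :
  act_t rho TM a (act_t rho TM b m) =
    rho (T a) (rho (T b) m) - lam *: rho a (rho b m)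
    - TM (rho a (rho (T b) m) + rho (T a) (rho b m) + mu *: rho a (rho b m)).
Proof.
have rhoB := zmod_morphism_linear (lie_repPr rho_lie a).
have rhoTB := zmod_morphism_linear (lie_repPr rho_lie (T a)).
rewrite /act_t rhoTB rhoB (extRB_repP M_rep) opprD !addrA.
rewrite (ACl (1*3*(2*4))) /= -opprD -linearD; congr (_ - TM _).
by rewrite !addrA (ACl ((4*2*3)*(1*5))) /= subrr addr0.
Qed.

(** Antisymmetrizing [act_t_act_t] in [a] and [b] produces commutators of [rho], hence actions of
    brackets: those outside [TM] assemble to [T (star_br a b)], those inside to [star_br a b]. *)
Lemma act_t_star_br a b m :
  act_t rho TM (star_br a b) m =
    act_t rho TM a (act_t rho TM b m) - act_t rho TM b (act_t rho TM a m).
Proof.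
have rhoB := zmod_morphism_linear (lie_repPl rho_lie m).
have [rhoZ rhoD] : semilinear (rho^~ m) :=
  GRing.semilinear_linear (lie_repPl rho_lie m).
have T_star : T (star_br a b) = lie_br (T a) (T b) - lam *: lie_br a b.
  by rewrite erb_opP addrK /star_br [X in T (X + _)]addrC.
rewrite !act_t_act_t /act_t T_star rhoB /star_br !rhoD !rhoZ.
rewrite !(lie_rep_br rho_lie) !scalerBr.
set P := TM _; set Q := TM _; set S := TM _.
have -> : P = Q - S.
  rewrite -linearB; congr (TM _).
  by rewrite !opprD !addrA (ACl (1*3*5*4*2*6)).
by rewrite !opprD !opprK !addrA (ACl (1*3*5*2*4*6)).
Qed.

Lemma act_t_extRB a m :
  act_t rho TM (T a) (TM m) =
    TM (act_t rho TM a (TM m) + act_t rho TM (T a) m + mu *: act_t rho TM a m)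
    + lam *: act_t rho TM a m.
Proof.
(* Subtracting [TM (rho b (TM m))] removes exactly the summand of the Rota-Baxter identity where
   [TM] is nested. *)
have act_tTM b : act_t rho TM b (TM m) =
    TM (rho (T b) m + mu *: rho b m) + lam *: rho b m.
  rewrite /act_t (extRB_repP M_rep) -[rho b _ + _ + _]addrA linearD.
  by rewrite addrAC [_ + TM (_ + _)]addrC addrK.
rewrite !act_tTM /act_t !scalerBr [lam *: rho (T a) m - _]addrC.
(* The term [lam *: TM (rho a m)] is moved under [TM], where it cancels the [lam] term of
   [act_tTM a]. *)
rewrite -[lam *: TM _]linearZ [RHS]addrA -linearB /=; congr (TM _ + _).
rewrite [TM (_ + _)]linearD [TM (mu *: _)]linearZ /= !addrA.
by rewrite (ACl (4*6*((1*5)*(2*7))*(3*8))) /= !subrr !addr0.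
Qed.

End DerivedAction.

Theorem proposition2p8 (k : fieldType) (k_char0 : [pchar k] =i pred0)
    (mu lam : k) (g : extRBLieAlgebra mu lam)
    (M : lmodType k) (rho : g -> M -> M) (TM : {linear M -> M})
    (M_rep : is_extRB_rep rho TM) :
  is_extRB_rep (g := star_extRBLie g) (act_t rho TM) TM.
Proof.
split; last exact: (act_t_extRB M_rep).
split; [exact: (act_tPl M_rep) | exact: (act_tPr M_rep)
  | exact: (act_t_star_br M_rep)].
Qed.
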